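(* Let $\mathcal{H}_1,\mathcal{H}_2$ be Hilbert spaces, $A\in L(\mathcal{H}_1,\mathcal{H}_2)$, and let $\mathcal{S}\subseteq\mathcal{H}_1$, $\mathcal{T}\subseteq\mathcal{H}_2$ be closed subspaces. The following statements are equivalent: 1. $A$ is $(\mathcal{S},\mathcal{T})$-weakly complementable. 2. If $A_{22}=U|A_{22}|$ is the polar decomposition of $A_{22}$, then the equations $A_{21}=|A_{22}^*|^{1/2}UX$ and $A_{12}^*=|A_{22}|^{1/2}Y$ have (bounded linear) solutions $X$, $Y$. 3. $\displaystyle\sup_{x\in\mathcal{T}^\perp}\frac{\|A_{21}^*x\|^2}{\langle|A_{22}^*|x,x\rangle}<\infty$ and $\displaystyle\sup_{y\in\mathcal{S}^\perp}\frac{\|A_{12}y\|^2}{\langle|A_{22}|y,y\rangle}<\infty$.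
   Context: $L(\mathcal{H}_1,\mathcal{H}_2)$ is the space of bounded linear operators; $R(\cdot)$ denotes range; $|T|=(T^*T)^{1/2}$. With $P_{\mathcal{M}}$ the orthogonal projection onto $\mathcal{M}$: $A_{11}=P_{\mathcal{T}}A|_{\mathcal{S}}\in L(\mathcal{S},\mathcal{T})$, $A_{12}=P_{\mathcal{T}}A|_{\mathcal{S}^\perp}\in L(\mathcal{S}^\perp,\mathcal{T})$, $A_{21}=P_{\mathcal{T}^\perp}A|_{\mathcal{S}}\in L(\mathcal{S},\mathcal{T}^\perp)$, $A_{22}=P_{\mathcal{T}^\perp}A|_{\mathcal{S}^\perp}\in L(\mathcal{S}^\perp,\mathcal{T}^\perp)$. $A$ is $(\mathcal{S},\mathcal{T})$-weakly complementable if $R(A_{21})\subseteq R(|A_{22}^*|^{1/2})$ and $R(A_{12}^* )\subseteq R(|A_{22}|^{1/2})$. In the suprema, quotients with zero denominator are read as $0/0=0$ and $a/0=+\infty$ for $a>0$. *)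

(* Defs.v *)
From HB Require Import structures.
From mathcomp Require Import all_boot all_order all_algebra.
From mathcomp Require Import all_classical all_reals all_analysis.
From mathcomp Require Import complex.

Set Implicit Arguments.
Unset Strict Implicit.
Unset Printing Implicit Defensive.

Import Order.TTheory GRing.Theory Num.Theory.
Import numFieldNormedType.Exports.

Local Open Scope classical_set_scope.
Local Open Scope ring_scope.

(* Hilbert spaces are complex; the inner product is linear in its first
   argument.  Norms of normed R[i]-modules take values in R[i]; positivity and
   definiteness of [inner] follow from [sqr_norm_inner]. *)
HB.mixin Record NormedModule_hasInner (R : realType) V
    of NormedModule R[i] V := {
  inner : V -> V -> R[i];
  innerPl : forall (a : R[i]) (x y z : V),
    inner (a *: x + y) z = a * inner x z + inner y z;
  innerC : forall x y : V, inner x y = (inner y x)^*;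
  sqr_norm_inner : forall x : V, `|x| ^+ 2 = inner x x
}.

#[short(type="hilbertType")]
HB.structure Definition Hilbert (R : realType) :=
  {V of CompleteNormedModule R[i] V & NormedModule_hasInner R V}.

Section ClosedSubspace.
Variables (R : realType) (H : hilbertType R).

Record closed_subspace := ClosedSubspace {
  csub_set : set H;
  csub_submod : submod_closed [pred x | x \in csub_set];
  csub_closed : closed csub_set
}.

Record csub_type (S : closed_subspace) := CSub {
  csub_val : H;
  csub_valP : [pred x | x \in csub_set S] csub_val
}.

End ClosedSubspace.

Section ClosedSubspaceHilbert.
Variables (R : realType) (H : hilbertType R) (S : closed_subspace H).

HB.instance Definition _ := [isSub for @csub_val R H S].
HB.instance Definition _ := [Choice of csub_type S by <:].

HB.instance Definition _ :=
  GRing.SubChoice_isSubLmodule.Build R[i] H _ (csub_type S)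
    (GRing.submod_closed_semi (csub_submod S)).

Let norm (x : csub_type S) : R[i] := `|\val x|.

Let ler_normD x y : norm (x + y) <= norm x + norm y.
Proof. by rewrite /norm raddfD ler_normD. Qed.

Let normrZ (a : R[i]) x : norm (a *: x) = `|a| * norm x.
Proof. by rewrite /norm linearZ normrZ. Qed.

Let normr0_eq0 x : norm x = 0 -> x = 0.
Proof. by move=> /normr0_eq0 x0; apply: val_inj; rewrite x0 raddf0. Qed.

HB.instance Definition _ :=
  Lmodule_isNormed.Build R[i] (csub_type S) ler_normD normrZ normr0_eq0.

Let cauchy_cvg (F : set_system (csub_type S)) : ProperFilter F -> cauchy F -> cvg F.
Proof.
move=> FF /cauchyP Fc.
have Gc : cauchy ((\val : csub_type S -> H) @ F).
  apply/cauchyP => e e0; have [x Fx] := Fc e e0.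
  exists (\val x); rewrite /fmap/=; apply: filterS Fx => y.
  by rewrite -!ball_normE /= -(raddfB (\val : csub_type S -> H)).
have Gl : cvg ((\val : csub_type S -> H) @ F) by exact: cauchy_cvg.
set l := lim ((\val : csub_type S -> H) @ F) in Gl.
have Sl : csub_set S l.
  have Sval : \forall y \near F, csub_set S (\val (y : csub_type S)).
    by apply: filterE => y; exact: (set_mem (csub_valP y)).
  exact: (closed_cvg _ (@csub_closed R H S) Sval _ Gl).
apply/cvg_ex; exists (CSub (mem_set Sl)).
apply/cvgrPdist_lt => e e0; move/cvgrPdist_lt: Gl => /(_ e e0).
by apply: filterS => y; rewrite -(raddfB (\val : csub_type S -> H) (CSub (mem_set Sl))).
Qed.

HB.instance Definition _ := Uniform_isComplete.Build (csub_type S) cauchy_cvg.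

Let form (x y : csub_type S) : R[i] := inner (\val x) (\val y).

Let formPl (a : R[i]) x y z : form (a *: x + y) z = a * form x z + form y z.
Proof. by rewrite /form linearP innerPl. Qed.

Let formC x y : form x y = (form y x)^*.
Proof. exact: innerC. Qed.

Let sqr_norm_form (x : csub_type S) : `|x| ^+ 2 = form x x.
Proof. exact: sqr_norm_inner. Qed.

HB.instance Definition _ :=
  NormedModule_hasInner.Build R (csub_type S) formPl formC sqr_norm_form.

End ClosedSubspaceHilbert.

(* Makes a closed subspace usable as a Hilbert space in its own right. *)
Definition csub_hilbert (R : realType) (H : hilbertType R)
  (S : closed_subspace H) : hilbertType R := csub_type S.
Coercion csub_hilbert : closed_subspace >-> Hilbert.type.

Section InnerTheory.
Variables (R : realType) (H : hilbertType R).
Implicit Types (a : R[i]) (x y z : H).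

Lemma innerDl x y z : inner (x + y) z = inner x z + inner y z.
Proof. by rewrite -[x in LHS]scale1r innerPl mul1r. Qed.

Lemma inner0l z : inner 0 z = 0 :> R[i].
Proof. by apply: (@addrI _ (inner 0 z)); rewrite -innerDl !addr0. Qed.

Lemma innerZl a x z : inner (a *: x) z = a * inner x z.
Proof. by rewrite -[a *: x]addr0 innerPl inner0l addr0. Qed.

Lemma innerNl x z : inner (- x) z = - inner x z.
Proof. by rewrite -scaleN1r innerZl mulN1r. Qed.

Lemma innerDr x y z : inner x (y + z) = inner x y + inner x z.
Proof. by rewrite innerC innerDl rmorphD /= -!innerC. Qed.

Lemma innerNr x z : inner x (- z) = - inner x z.
Proof. by rewrite innerC innerNl rmorphN /= -innerC. Qed.

Lemma innerZr a x z : inner x (a *: z) = a^* * inner x z.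
Proof. by rewrite innerC innerZl rmorphM /= -innerC. Qed.

Lemma inner_orth_norm x y : inner x y = 0 -> `|x| <= `|x - y|.
Proof.
move=> xy0; have yx0 : inner y x = 0 by rewrite innerC xy0 rmorph0.
rewrite -(ler_pXn2r (n := 2)) ?nnegrE// !sqr_norm_inner.
rewrite innerDl !innerDr !innerNl !innerNr xy0 yx0 oppr0 addr0 sub0r !opprK.
by rewrite lerDl -sqr_norm_inner exprn_ge0.
Qed.

Lemma norm_inner_le x y : `|inner x y| <= `|x| * `|y|.
Proof.
have [->|y0] := eqVneq y 0.
  by rewrite innerC inner0l rmorph0 normr0 mulr_ge0.
have yy0 : inner y y != 0 by rewrite -sqr_norm_inner expf_neq0// normr_eq0.
pose c := inner x y / inner y y.
have : `|c *: y| <= `|c *: y - (c *: y - x)|.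
  apply: inner_orth_norm; rewrite innerDr innerNr !innerZl innerZr.
  have -> : c^* * inner y y = inner y x.
    by rewrite {1}innerC -rmorphM divfK//= -innerC.
  by rewrite subrr.
rewrite subKr normrZ normrM normfV -sqr_norm_inner normrX normr_id expr2.
rewrite invfM mulrA divfK ?normr_eq0//.
by rewrite ler_pdivrMr// normr_gt0.
Qed.

End InnerTheory.

Section Orthogonal.
Variables (R : realType) (H : hilbertType R) (S : closed_subspace H).

Definition orth_set : set H :=
  [set x | forall s, csub_set S s -> inner x s = 0].

Lemma orth_submod : submod_closed [pred x | x \in orth_set].
Proof.
split=> [|a x y]; rewrite !inE; first by move=> s _; rewrite inner0l.
move=> xS yS s Ss.
by rewrite innerPl xS// yS// mulr0 addr0.
Qed.

Lemma orth_closed : closed orth_set.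
Proof.
move=> x clx s Ss; apply/eqP; rewrite -normr_le0; apply/ler_addgt0Pl => e e0.
rewrite addr0; have s1 : 0 < `|s| + 1 by rewrite ltr_wpDl.
have := clx _ (nbhsx_ballx x (e / (`|s| + 1)) (divr_gt0 e0 s1)).
rewrite -ball_normE => -[y [Sy /= xy]].
have -> : inner x s = inner (x - y) s by rewrite innerDl innerNl Sy// subr0.
apply: le_trans (norm_inner_le _ _) _.
apply: (@le_trans _ _ (e / (`|s| + 1) * (`|s| + 1))); last by rewrite divfK ?gt_eqF.
by apply: ler_pM => //; [exact: ltW | rewrite lerDl].
Qed.

Definition orthc : closed_subspace H := ClosedSubspace orth_submod orth_closed.

End Orthogonal.

Section Operators.
Variable R : realType.
Implicit Types H K : hilbertType R.

Record bop H K := BOp {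
  bop_fun :> {linear H -> K};
  bop_bounded : exists M : R[i], forall x, `|bop_fun x| <= M * `|x|
}.

HB.instance Definition _ H K := gen_eqMixin (bop H K).
HB.instance Definition _ H K := gen_choiceMixin (bop H K).

Lemma bop0_bounded H K :
  exists M : R[i], forall x, `|(\0 : {linear H -> K}) x| <= M * `|x|.
Proof. by exists 0 => x; rewrite normr0 mul0r. Qed.

Definition bop0 H K : bop H K := BOp (bop0_bounded H K).

Lemma bop_comp_bounded H K L (A : bop K L) (B : bop H K) :
  exists M : R[i], forall x, `|(A \o B) x| <= M * `|x|.
Proof.
have [M AM] := bop_bounded A; have [N BN] := bop_bounded B.
have MR x : `|A x| <= `|M| * `|x|.
  apply: le_trans (AM x) _; have [->|x0] := eqVneq x 0.
    by rewrite normr0 !mulr0.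
  have M0 : 0 <= M.
    have := le_trans (normr_ge0 _) (AM x).
    by rewrite pmulr_lge0// normr_gt0.
  by rewrite ger0_norm.
exists (`|M| * N) => x /=; apply: le_trans (MR _) _.
by rewrite -mulrA ler_wpM2l.
Qed.

Definition bop_comp H K L (A : bop K L) (B : bop H K) : bop H L :=
  BOp (bop_comp_bounded A B).

Lemma bop_incl_bounded H (S : closed_subspace H) :
  exists M : R[i], forall x, `|(\val : {linear csub_type S -> H}) x| <= M * `|x|.
Proof. by exists 1 => x; rewrite mul1r. Qed.

Definition bop_incl H (S : closed_subspace H) : bop S H :=
  BOp (bop_incl_bounded S).

(* The operators below are defined by their characterizations; existence and
   uniqueness are classical, so the default value [bop0] of [xget] is never
   taken (Riesz representation, projection theorem, square root of a positive
   operator; [bop_sqrt] is meant for positive operators only). *)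
Definition bop_adj H K (A : bop H K) : bop K H :=
  xget (bop0 K H) [set B | forall x y, inner (A x) y = inner x (B y)].

Definition bop_proj H (S : closed_subspace H) : bop H S :=
  xget (bop0 H S)
    [set P | forall x s, csub_set S s -> inner (x - bop_incl S (P x)) s = 0].

(* [0 <= z] in R[i] means that z is real and nonnegative. *)
Definition bop_pos H (A : bop H H) := forall x, 0 <= inner (A x) x.

Definition bop_sqrt H (A : bop H H) : bop H H :=
  xget (bop0 H H) [set B | bop_pos B /\ B \o B =1 A].

Definition bop_abs H K (A : bop H K) : bop H H :=
  bop_sqrt (bop_comp (bop_adj A) A).

(* The last two clauses say that U is a partial isometry (isometric on the
   orthogonal complement of its kernel) with the same kernel as A, which makes
   U unique. *)
Definition polar_decomposition H K (A U : bop H K) :=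
  [/\ A =1 U \o bop_abs A,
      forall x, (forall z, U z = 0 -> inner x z = 0) -> `|U x| = `|x| &
      forall x, U x = 0 <-> A x = 0].

Definition bop_block H K (A : bop H K) (S : closed_subspace H)
    (T : closed_subspace K) : bop S T :=
  bop_comp (bop_proj T) (bop_comp A (bop_incl S)).

Section Complementable.
Variables (H K : hilbertType R) (A : bop H K).
Variables (S : closed_subspace H) (T : closed_subspace K).

Definition block12 := bop_block A (orthc S) T.
Definition block21 := bop_block A S (orthc T).
Definition block22 := bop_block A (orthc S) (orthc T).

Definition weakly_complementable :=
  range block21 `<=` range (bop_sqrt (bop_abs (bop_adj block22))) /\
  range (bop_adj block12) `<=` range (bop_sqrt (bop_abs block22)).

End Complementable.

(* [sup_x |B x|^2 / <P x, x>] for P positive.  The division of extended reals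
   is such that 0 / 0 = 0 and a / 0 = +oo for a > 0. *)
Definition sup_quotient H K (B : bop H K) (P : bop H H) : \bar R :=
  ereal_sup [set ((complex.Re (`|B x| ^+ 2))%:E /
                  (complex.Re (inner (P x) x))%:E)%E | x in [set: H]].

End Operators.

(* Main.v *)
(* Everything rests on one minimization: for linear [f] and a real functional
   [phi] with |phi x| <= c |f x|, a minimizing sequence of |f x|^2 - 2 phi x is
   Cauchy along [f], and its limit [y] satisfies <f x, y> = phi x.  This yields
   adjoints and, applied to D^*, the majorization half of Douglas' lemma
   (|B^* x| <= c |D^* x| implies B = D X).  A range inclusion implies the
   majorization by uniform boundedness, so (1) <-> (3) because
   |P^(1/2) y|^2 = <P y, y>.  The polar factor of C is U = V^*, where
   C^* = |C| V is given by Douglas' lemma.  For (1) -> (2), a solution X0 of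
   A21 = |C^*|^(1/2) X0 gives X = U^* X0, since |C^*|^(1/2) U U^* = |C^*|^(1/2).
   The existence of |C| and |C|^(1/2) comes from the iteration
   Y |-> (W + Y^2)/2 for sqrt(1 - W). *)

Require Import Defs.
From HB Require Import structures.
From mathcomp Require Import all_boot all_order all_algebra.
From mathcomp Require Import all_classical all_reals all_analysis.
From mathcomp Require Import complex ring lra.

Set Implicit Arguments.
Unset Strict Implicit.
Unset Printing Implicit Defensive.

Import Order.TTheory GRing.Theory Num.Theory.
Import numFieldNormedType.Exports.

Local Open Scope classical_set_scope.
Local Open Scope ring_scope.
Local Open Scope complex_scope.

(** * Real inner product, real norm, and limits with a rate *)

Lemma cvg0_mul (R : realType) (c : R) (d : nat -> R) :
  d @ \oo --> 0 -> (fun n => c * d n) @ \oo --> 0.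
Proof. by move=> d0; rewrite -[X in _ --> X](mulr0 c); exact: cvgM (cvg_cst _) d0. Qed.

Section RealForms.
Variables (R : realType) (H : hilbertType R).
Implicit Types (x y z : H) (t : R).

Definition rnorm x : R := complex.Re `|x|.
Definition rinner x y : R := complex.Re (inner x y).

Lemma normE x : `|x| = (rnorm x)%:C.
Proof. by rewrite /rnorm RRe_real// ger0_real. Qed.

Lemma rnorm_ge0 x : 0 <= rnorm x.
Proof. by rewrite -ler0c -normE. Qed.

Lemma rinnerxx x : rinner x x = rnorm x ^+ 2.
Proof. by rewrite /rinner -sqr_norm_inner normE -rmorphXn. Qed.

Lemma innerxx x : inner x x = (rnorm x ^+ 2)%:C.
Proof. by rewrite -sqr_norm_inner normE rmorphXn. Qed.

Lemma rinnerC x y : rinner x y = rinner y x.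
Proof. by rewrite /rinner innerC; case: (inner y x). Qed.

Lemma rinnerDl x y z : rinner (x + y) z = rinner x z + rinner y z.
Proof. by rewrite /rinner innerDl raddfD. Qed.

Lemma rinnerNl x z : rinner (- x) z = - rinner x z.
Proof. by rewrite /rinner innerNl raddfN. Qed.

Lemma rinnerZl t x z : rinner (t%:C *: x) z = t * rinner x z.
Proof. by rewrite /rinner innerZl; case: (inner x z) => a b /=; rewrite mul0r subr0. Qed.

Lemma rinnerDr x y z : rinner z (x + y) = rinner z x + rinner z y.
Proof. by rewrite rinnerC rinnerDl !(rinnerC z). Qed.

Lemma rinnerNr x z : rinner z (- x) = - rinner z x.
Proof. by rewrite rinnerC rinnerNl (rinnerC z). Qed.

Lemma rinnerZr t x z : rinner z (t%:C *: x) = t * rinner z x.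
Proof. by rewrite rinnerC rinnerZl (rinnerC z). Qed.

Definition rinnerE := (rinnerDl, rinnerDr, rinnerNl, rinnerNr, rinnerZl, rinnerZr).

Lemma inner0r x : inner x 0 = 0.
Proof. by rewrite innerC inner0l rmorph0. Qed.

Lemma rinner0l x : rinner 0 x = 0.
Proof. by rewrite /rinner inner0l. Qed.

Lemma inner_rinner x y : inner x y = rinner x y +i* rinner x ('i *: y).
Proof.
rewrite /rinner innerZr; case: (inner x y) => a b /=.
by rewrite mul0r sub0r mulNr opprK mul1r.
Qed.

Lemma rnorm0 : rnorm 0 = 0.
Proof. by rewrite /rnorm normr0. Qed.

Lemma rnorm_eq0 x : rnorm x = 0 -> x = 0.
Proof. by move=> x0; apply/normr0_eq0; rewrite normE x0. Qed.

Lemma rnormD x y : rnorm (x + y) <= rnorm x + rnorm y.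
Proof. by rewrite -lecR rmorphD /= -!normE ler_normD. Qed.

Lemma rnormN x : rnorm (- x) = rnorm x.
Proof. by rewrite /rnorm normrN. Qed.

Lemma rnormB x y : rnorm (x - y) = rnorm (y - x).
Proof. by rewrite -rnormN opprB. Qed.

Lemma rnorm_trans x y z : rnorm (x - z) <= rnorm (x - y) + rnorm (y - z).
Proof. by apply: le_trans (rnormD _ _); rewrite addrA subrK. Qed.

Lemma rnormZ (a : R[i]) x : rnorm (a *: x) = complex.Re `|a| * rnorm x.
Proof.
apply: complexI; rewrite -normE normrZ rmorphM /= -normE; congr (_ * _).
Qed.

Lemma rnormZr t x : rnorm (t%:C *: x) = `|t| * rnorm x.
Proof. by rewrite rnormZ normc_def /= expr0n /= addr0 sqrtr_sqr. Qed.

Lemma rinner_le x y : `|rinner x y| <= rnorm x * rnorm y.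
Proof.
rewrite -lecR rmorphM /= -!normE; apply: le_trans (norm_inner_le x y).
exact: normc_ge_Re.
Qed.

Lemma rinner_le1 x y : rinner x y <= rnorm x * rnorm y.
Proof. exact: le_trans (ler_norm _) (rinner_le x y). Qed.

Lemma rinner_ext x y : (forall z, rinner z x = rinner z y) -> x = y.
Proof.
move=> xy; apply/eqP; rewrite -subr_eq0; apply/eqP/rnorm_eq0/eqP.
by rewrite -sqrf_eq0 -rinnerxx rinnerDr rinnerNr xy subrr.
Qed.

Lemma inner_extr x y : (forall z, inner z x = inner z y) -> x = y.
Proof. by move=> xy; apply: rinner_ext => z; rewrite /rinner xy. Qed.


(** Completeness with an explicit rate: [d n] also bounds the distance to the limit, so later limit
    arguments become inequalities against one null sequence. *)
Lemma cvg_rate (u : nat -> H) (d : nat -> R) : d @ \oo --> 0 ->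
    (forall n m, (n <= m)%N -> rnorm (u n - u m) <= d n) ->
  exists y, forall n, rnorm (u n - y) <= d n.
Proof.
move=> d0 ud.
have /cauchy_cvgP/cvg_ex[y uy] : cauchy (u @ \oo).
  apply/cauchyP => e e0.
  have eE : e = (complex.Re e)%:C by rewrite RRe_real// gtr0_real.
  have e0' : 0 < complex.Re e by rewrite -ltcR -eE.
  move/cvgrPdist_lt: d0 => /(_ _ e0')[N _ dN].
  exists (u N); exists N => // n /= Nn; rewrite -ball_normE/= normE eE ltcR.
  apply: le_lt_trans (ud _ _ Nn) _; apply: le_lt_trans (dN _ (leqnn N)).
  by rewrite sub0r normrN ler_norm.
exists y => n; apply/ler_addgt0Pl => e e0.
have ec0 : 0 < e%:C by rewrite ltcR.
move/cvgrPdist_lt: uy => /(_ _ ec0)[N _ uN].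
have := uN _ (leq_maxl N n); rewrite /= normE ltcR => uye.
rewrite rnormB; apply: le_trans (rnorm_trans _ (u (maxn N n)) _) _.
by apply: lerD; [exact: ltW | rewrite rnormB; exact/ud/leq_maxr].
Qed.

End RealForms.

Lemma le0_rate (R : realType) (d : nat -> R) (a c : R) :
  d @ \oo --> 0 -> (forall n, a <= c * d n) -> a <= 0.
Proof.
move=> d0 ad; have cd0 := @cvg0_mul _ c _ d0; have := limr_ge (cvgP _ cd0) (nearW _ ad).
by rewrite (cvg_lim (@Rhausdorff R) cd0); exact.
Qed.

Lemma eq_rate (R : realType) (d : nat -> R) (a b c : R) :
  d @ \oo --> 0 -> (forall n, `|a - b| <= c * d n) -> a = b.
Proof.
move=> d0 abd; apply/eqP; rewrite -subr_eq0 -normr_le0.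
exact: le0_rate d0 abd.
Qed.

(** The range of [f] need not be closed, so [y] is found in its closure; the last clause records
    this and, with the first, determines [y]. *)
Lemma riesz_range (R : realType) (E : lmodType R[i]) (H : hilbertType R)
    (f : {linear E -> H}) (phi : E -> R) (c : R) : 0 <= c ->
    {morph phi : x y / x + y} -> (forall t x, phi (t%:C *: x) = t * phi x) ->
    (forall x, `|phi x| <= c * rnorm (f x)) ->
  exists y, [/\ forall x, rinner (f x) y = phi x, rnorm y <= c &
    forall z, (forall x, rinner (f x) z = 0) -> rinner y z = 0].
Proof.
move=> c0 phiD phiZ phi_le.
have [h [h_gt0 h0 h_mono]] : exists h : nat -> R, [/\ forall n, 0 < h n,
    h @ \oo --> 0 & forall n k, (n <= k)%N -> h k <= h n].
  exists harmonic; split=> [||n k nk]; [exact: harmonic_gt0|exact: cvg_harmonic|].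
  by rewrite lef_pV2 ?posrE ?ltr0n// ler_nat.
have h_ge0 n : 0 <= h n by exact: ltW.
(* If [y] represents [phi], then [J x = |f x - y|^2 - |y|^2], so minimizing [J] means approaching
   [y]. *)
pose J x := rnorm (f x) ^+ 2 - 2 * phi x.
have JE x : J x = rinner (f x) (f x) - 2 * phi x by rewrite rinnerxx.
have Jge x : - c ^+ 2 <= J x.
  have := phi_le x; rewrite ler_norml => /andP[_ phix].
  have := sqr_ge0 (rnorm (f x) - c); rewrite /J; nra.
have Jinf : has_inf (range J).
  by split; [exists (J 0), 0 | exists (- c ^+ 2) => _ [x _ <-]].
pose m := inf (range J).
have mJ x : m <= J x by apply: ge_inf; [exact: Jinf.2 | exists x].
have /choice[u uJ] : forall n, exists x, J x < m + h n ^+ 2.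
  move=> n.
  by have [_ [x _ <-] xm] := inf_adherent (exprn_gt0 2 (h_gt0 n)) Jinf; exists x.
(* Parallelogram law at the midpoint [w] of [u n] and [u k]: [|f (u n) - f (u k)|^2 = 2 J (u n) + 2
   J (u k) - 4 J w], at most [4 (h n)^2] for [n <= k]. *)
have [y uy] : exists y, forall n, rnorm (f (u n) - y) <= 2 * h n.
  apply: cvg_rate => [|n k nk].
    exact: cvg0_mul.
  rewrite -ler_sqr ?nnegrE ?rnorm_ge0 ?mulr_ge0// -rinnerxx.
  have := uJ n; have := uJ k; have := mJ ((2^-1)%:C *: (u n + u k)).
  rewrite !JE linearZ linearD /= phiZ phiD !rinnerE (rinnerC (f (u k)) (f (u n))).
  have : h k ^+ 2 <= h n ^+ 2 by rewrite ler_sqr ?nnegrE// h_mono.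
  lra.
have fu n : rnorm (f (u n)) <= rnorm y + 2 * h n.
  by apply: le_trans (lerD (lexx _) (uy n)); rewrite -{1}(subrK y (f _)) addrC rnormD.
have fy x : rinner (f x) y = phi x.
apply: (eq_rate (c := (1 + rnorm (f x) ^+ 2) / 2 + 2 * rnorm (f x)) h0).
    move=> n;
  have -> : rinner (f x) y - phi x =
      (rinner (f x) (f (u n)) - phi x) - rinner (f x) (f (u n) - y).
    by rewrite !rinnerE; ring.
  apply: le_trans (ler_normB _ _) _; rewrite mulrDl; apply: lerD; last first.
    apply: le_trans (rinner_le _ _) _.
    by rewrite (mulrC 2) -mulrA ler_wpM2l ?rnorm_ge0.
  (* Near-minimality of [u n] makes this quadratic in [t] nonnegative; [t = h n] and [t = - h n]
     bound its linear coefficient. *)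
  have K t : 0 <= h n ^+ 2 + 2 * t * (rinner (f x) (f (u n)) - phi x) +
      t ^+ 2 * rnorm (f x) ^+ 2.
    have := mJ (u n + t%:C *: x); have := uJ n.
    rewrite !JE -rinnerxx phiD phiZ (linearD f) (linearZ_LR f) /= !rinnerE.
    rewrite (rinnerC (f (u n)) (f x)); lra.
  have := K (h n); have := K (- h n).
  set z := rinner _ _ - _; set q := rnorm _ => K1 K2.
  rewrite ler_norml; apply/andP; split; rewrite -(ler_pM2l (h_gt0 n)); nra.
exists y; split=> // [|z fz].
  have [->|y0] := eqVneq (rnorm y) 0; first exact: c0.
  have y1 : 0 < rnorm y by rewrite lt_neqAle eq_sym y0 rnorm_ge0.
  (* [|y| (|y| - c) <= 0] results from [|y|^2 = <y - f (u n), y> + phi (u n)] as [n] grows. *)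
  rewrite -subr_le0 -(pmulr_rle0 _ y1).
  apply: (le0_rate (c := 2 * (rnorm y + c)) h0).
  move=> n; rewrite mulrBr -expr2 -rinnerxx.
  have := rinner_le1 (y - f (u n)) y; rewrite rnormB rinnerDl rinnerNl fy.
  have := le_trans (ler_norm _) (phi_le (u n)).
  have := ler_wpM2l c0 (fu n); have := ler_wpM2l (ltW y1) (uy n).
  lra.
apply: (eq_rate (c := 2 * rnorm z) h0).
move=> n; have -> : rinner y z - 0 = rinner (y - f (u n)) z.
  by rewrite rinnerDl rinnerNl fz.
apply: le_trans (rinner_le _ _) _; rewrite rnormB [leRHS]mulrAC.
by rewrite ler_wpM2r ?rnorm_ge0.
Qed.

(** * Bounded operators, adjoints and Douglas factorization *)

Lemma bop_rbounded (R : realType) (H K : hilbertType R) (A : bop H K) :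
  exists2 c, 0 < c & forall x, rnorm (A x) <= c * rnorm x.
Proof.
have [M AM] := bop_bounded A.
have [c cM] : exists c : R, `|M| = c%:C.
  by exists (complex.Re `|M|); rewrite RRe_real// ger0_real.
have c0 : 0 <= c by rewrite -ler0c -cM.
(* Adding 1 keeps the constant positive even for the zero operator. *)
exists (c + 1) => [|x]; first by rewrite ltr_wpDl.
apply: (@le_trans _ _ (c * rnorm x)); last first.
  by rewrite ler_wpM2r ?rnorm_ge0// lerDl.
rewrite -lecR rmorphM /= -!normE -cM.
have [->|x0] := eqVneq x 0; first by rewrite raddf0 !normr0 mulr0.
apply: le_trans (AM x) _; rewrite ler_wpM2r// ger0_norm//.
have := le_trans (normr_ge0 _) (AM x); rewrite pmulr_lge0//.
by rewrite lt_neqAle eq_sym normr_eq0 x0 normr_ge0.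
Qed.

Lemma bop_of_linear (R : realType) (H K : hilbertType R) (f : H -> K) (c : R) :
  (forall (a : R[i]) x y, f (a *: x + y) = a *: f x + f y) ->
  (forall x, rnorm (f x) <= c * rnorm x) -> exists F : bop H K, F =1 f.
Proof.
move=> flin fc.
pose F : {linear H -> K} := HB.pack f (GRing.isLinear.Build _ _ _ _ _ flin).
have Fb : exists M : R[i], forall x, `|F x| <= M * `|x|.
  by exists c%:C => x; rewrite !normE -rmorphM lecR; exact: fc.
by exists (BOp Fb).
Qed.

Lemma inner_rinnerl (R : realType) (H : hilbertType R) (x y : H) :
  inner x y = rinner x y +i* rinner (- 'i *: x) y.
Proof.
rewrite /rinner innerZl; case: (inner x y) => a b /=.
by rewrite !(mul0r, sub0r, mulN1r, opprK, oppr0).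
Qed.

(** In effect [g = X^* f]: the identity as [f] gives adjoints, and [f = D^*], [g = B^*] gives
    Douglas' lemma. The last clause keeps the values of [X] in the closure of the range of [f],
    which makes them unique and hence [X] linear. *)
Lemma riesz_op (R : realType) (E : lmodType R[i]) (H L : hilbertType R)
    (f : {linear E -> L}) (g : {linear E -> H}) (c : R) :
    (forall x, rnorm (g x) <= c * rnorm (f x)) ->
  exists X : bop H L, (forall x h, inner (g x) h = inner (f x) (X h)) /\
    (forall z h, (forall x, inner (f x) z = 0) -> inner (X h) z = 0).
Proof.
move=> gf.
have gf' x : rnorm (g x) <= `|c| * rnorm (f x).
  by apply: le_trans (gf x) _; rewrite ler_wpM2r ?rnorm_ge0// ler_norm.
have /choice[X XP] : forall h, exists y,
    [/\ forall x, inner (g x) h = inner (f x) y, rnorm y <= `|c| * rnorm h &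
      forall z, (forall x, inner (f x) z = 0) -> inner y z = 0].
  move=> h.
  have [|x y|t x|x|y [fy yc yz]] := @riesz_range R E L f (fun x => rinner (g x) h)
      (`|c| * rnorm h).
  - by rewrite mulr_ge0 ?rnorm_ge0.
  - by rewrite linearD rinnerDl.
  - by rewrite linearZ rinnerZl.
  - apply: le_trans (rinner_le _ _) _; rewrite mulrAC.
    by rewrite ler_wpM2r ?rnorm_ge0.
  exists y; split=> // [x|z fz].
    (* The real identity at [x] and at [- 'i *: x] gives the complex one. *)
    by rewrite !inner_rinnerl -(linearZ_LR g) -(linearZ_LR f) !fy.
  rewrite inner_rinner !yz// => x; rewrite /rinner ?innerZr fz//.
  by rewrite mulr0.
have Xlin (a : R[i]) h k : X (a *: h + k) = a *: X h + X k.
  have [Xh _ zh] := XP h; have [Xk _ zk] := XP k.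
  have [Xhk _ zhk] := XP (a *: h + k).
  apply/eqP; rewrite -subr_eq0; apply/eqP/rnorm_eq0/eqP; rewrite -sqrf_eq0.
  set d := (X (a *: h + k) - _).
  (* [d] is orthogonal to the range of [f], hence to the three values of [X] that compose it, hence
     to itself. *)
  have fd x : inner (f x) d = 0.
    rewrite /d innerDr innerNr innerDr innerZr -Xhk -Xh -Xk innerDr innerZr.
    by rewrite subrr.
  rewrite -rinnerxx {1}/d /rinner innerDl innerNl innerDl innerZl.
  by rewrite zhk// zh// zk// mulr0 addr0 oppr0 addr0.
have [|F FX] := bop_of_linear Xlin (c := `|c|).
  by move=> h; have [] := XP h.
exists F; split=> [x h|z h fz]; rewrite FX; have [Xh _ zh] := XP h.
  exact: Xh.
exact: zh.
Qed.

Section Adjoint.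
Variables (R : realType) (H K : hilbertType R).
Implicit Types A : bop H K.

Lemma bop_adjP A x y : inner (A x) y = inner x (bop_adj A y).
Proof.
rewrite /bop_adj; case: xgetP => [B _ AB|]; first exact: AB.
have [c c0 Ac] := bop_rbounded A.
have [X [XP _]] := @riesz_op _ _ _ _ idfun A c Ac.
by move=> /(_ X); case.
Qed.

Lemma bop_adjPr A x y : inner y (A x) = inner (bop_adj A y) x.
Proof. by rewrite innerC bop_adjP -innerC. Qed.

End Adjoint.

Lemma bop_adjK (R : realType) (H K : hilbertType R) (A : bop H K) :
  bop_adj (bop_adj A) =1 A.
Proof. by move=> x; apply: inner_extr => z; rewrite -bop_adjP -bop_adjPr. Qed.

(** The second clause puts the range of [X] in the orthogonal complement of the kernel of [D]; it
    later gives the polar factor the right kernel. *)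
Lemma douglas_factor (R : realType) (H K L : hilbertType R) (B : bop H K)
    (D : bop L K) (c : R) :
    (forall x, rnorm (bop_adj B x) <= c * rnorm (bop_adj D x)) ->
  exists X : bop H L, B =1 D \o X /\
    (forall z h, D z = 0 -> inner (X h) z = 0).
Proof.
move=> BD; have [X [BX Xz]] := @riesz_op _ _ _ _ (bop_adj D) (bop_adj B) c BD.
exists X; split=> [h|z h Dz].
  by apply: inner_extr => z /=; rewrite bop_adjPr BX -bop_adjPr.
by apply: Xz => x; rewrite -bop_adjPr Dz inner0r.
Qed.

Definition bop_self (R : realType) (H : hilbertType R) (A : bop H H) :=
  forall x y, inner (A x) y = inner x (A y).

Section Positive.
Variables (R : realType) (H : hilbertType R) (A : bop H H).
Hypothesis A_pos : bop_pos A.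

(** Polarization: [<A z, z>] is real at [x + y] and at [x + 'i *: y], which yields the two real
    equations of symmetry. *)
Lemma bop_pos_self : bop_self A.
Proof.
have im0 z : complex.Im (inner (A z) z) = 0.
  by have := A_pos z; rewrite lecE => /andP[/eqP].
move=> x y; rewrite [RHS]innerC.
have := im0 (x + y); have := im0 (x + 'i *: y).
rewrite !linearD linearZ_LR !(innerDl, innerDr, innerZl, innerZr).
have := im0 x; have := im0 y.
case: (inner (A x) x) => a1 b1 /=; case: (inner (A y) y) => a2 b2 /=.
case: (inner (A x) y) => a3 b3; case: (inner (A y) x) => a4 b4 /= -> -> h1 h2.
apply/eqP; rewrite eq_complex /=; apply/andP; split; apply/eqP; lra.
Qed.

Lemma rinner_pos x : 0 <= rinner (A x) x.
Proof. by have := A_pos x; rewrite lecE => /andP[]. Qed.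

(** Expand [<A w, w> >= 0] at [w = c x - A x] and bound [<A (A x), A x>] by [c |A x|^2]. *)
Lemma bop_pos_sqr_le c x : 0 < c -> (forall x, rnorm (A x) <= c * rnorm x) ->
  rnorm (A x) ^+ 2 <= c * rinner (A x) x.
Proof.
move=> c0 Ac; have := rinner_pos (c%:C *: x - A x).
have := le_trans (rinner_le1 _ _) (ler_wpM2r (rnorm_ge0 (A x)) (Ac (A x))).
rewrite -mulrA -expr2 linearB linearZ_LR /= !rinnerE -rinnerxx.
have -> : rinner (A (A x)) x = rinner (A x) (A x) by rewrite /rinner bop_pos_self.
move=> h1 h2; rewrite -(ler_pM2l c0); lra.
Qed.

End Positive.

(** * Square roots of positive operators *)

Lemma vect_eq_rate (R : realType) (H : hilbertType R) (d : nat -> R)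
    (x y : H) (c : R) :
  d @ \oo --> 0 -> (forall n, rnorm (x - y) <= c * d n) -> x = y.
Proof.
move=> d0 xyd; apply/eqP; rewrite -subr_eq0; apply/eqP/rnorm_eq0/le_anti.
by rewrite rnorm_ge0 andbT; exact: le0_rate d0 xyd.
Qed.

Section SquareRoot.
Variables (R : realType) (H : hilbertType R) (W : bop H H).
Hypothesis W_self : bop_self W.
Hypothesis W_le1 : forall x, rnorm (W x) <= rnorm x.

(* The norm of [sqrt_iter n] is at most [sqrt_rate n], the same iteration for
   the scalar 1; both converge, and [sqrt_rate] to 1. *)
Fixpoint sqrt_iter n (x : H) : H :=
  if n is m.+1 then (2^-1)%:C *: (W x + sqrt_iter m (sqrt_iter m x)) else 0.

Fixpoint sqrt_rate n : R :=
  if n is m.+1 then (1 + sqrt_rate m ^+ 2) / 2 else 0.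

Local Notation Y := sqrt_iter.
Local Notation y := sqrt_rate.

Lemma sqrt_iterS n x : Y n.+1 x = (2^-1)%:C *: (W x + Y n (Y n x)).
Proof. by []. Qed.

Lemma sqrt_rate_ge0 n : 0 <= y n.
Proof. by case: n => //= n; have := sqr_ge0 (y n); lra. Qed.

Lemma sqrt_rate_ler n : y n <= y n.+1.
Proof. by rewrite /=; have := sqr_ge0 (1 - y n); lra. Qed.

Lemma sqrt_rate_le1 n : y n <= 1.
Proof.
elim: n => //= n IH; have := sqrt_rate_ge0 n; set t := y n in IH *; clearbody t.
by move=> t0; nra.
Qed.

(** With [e = 1 - y n] the recursion reads [e' = e (1 + y n) / 2 = e - e^2 / 2], and the bound
    [e <= 2 / (n + 2)] survives this step. *)
Lemma sqrt_rate_le n : (1 - y n) * (n%:R + 2) <= 2.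
Proof.
elim: n => [|n IH] /=; first by rewrite add0r subr0 mul1r.
have := sqr_ge0 (1 - y n); have : 0 <= 1 + y n by rewrite addr_ge0 ?sqrt_rate_ge0.
move: IH; rewrite -subr_ge0 => IH y0; have := mulr_ge0 IH y0.
rewrite -[n.+1%:R]natr1; lra.
Qed.

Lemma sqrt_rate_cvg : (fun n => 1 - y n) @ \oo --> 0.
Proof.
apply: (@squeeze_cvgr _ _ _ _ (fun=> 0) (fun n => 2 * harmonic n)).
- apply: nearW => n; rewrite subr_ge0 sqrt_rate_le1 /= ler_pdivlMr ?ltr0n//.
  have := sqrt_rate_le n; have := sqrt_rate_le1 n; rewrite -[n.+1%:R]natr1; nra.
- exact: cvg_cst.
- by apply: cvg0_mul; exact: cvg_harmonic.
Qed.

Lemma sqrt_iter_lin n (a : R[i]) x z : Y n (a *: x + z) = a *: Y n x + Y n z.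
Proof.
elim: n x z => [|n IH] x z /=; first by rewrite scaler0 addr0.
rewrite !IH linearP !scalerDr !scalerA (mulrC a) -!addrA; congr (_ + _).
by rewrite addrCA.
Qed.

Lemma sqrt_iterD n x z : Y n (x + z) = Y n x + Y n z.
Proof. by have := sqrt_iter_lin n 1 x z; rewrite !scale1r. Qed.

Lemma sqrt_iter0 n : Y n 0 = 0.
Proof. by apply: (addrI (Y n 0)); rewrite -sqrt_iterD !addr0. Qed.

Lemma sqrt_iterZ n (a : R[i]) x : Y n (a *: x) = a *: Y n x.
Proof. by have := sqrt_iter_lin n a x 0; rewrite sqrt_iter0 !addr0. Qed.

Lemma sqrt_iterB n x z : Y n (x - z) = Y n x - Y n z.
Proof. by rewrite sqrt_iterD -scaleN1r sqrt_iterZ scaleN1r. Qed.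

Lemma sqrt_iter_commW n x : Y n (W x) = W (Y n x).
Proof.
elim: n x => [|n IH] x /=; first by rewrite linear0.
by rewrite (linearZ_LR W) (linearD W) !IH.
Qed.

Lemma sqrt_iter_comm n m x : Y n (Y m x) = Y m (Y n x).
Proof.
elim: n x => [|n IH] x /=; first by rewrite sqrt_iter0.
by rewrite sqrt_iterZ sqrt_iterD sqrt_iter_commW !IH.
Qed.

Lemma sqrt_iter_self n x z : rinner (Y n x) z = rinner x (Y n z).
Proof.
elim: n x z => [|n IH] x z /=; first by rewrite rinner0l rinnerC rinner0l.
by rewrite !rinnerE !IH /rinner W_self.
Qed.

Lemma sqrt_iter_le n x : rnorm (Y n x) <= y n * rnorm x.
Proof.
elim: n x => [|n IH] x /=; first by rewrite rnorm0 mul0r.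
rewrite rnormZr ger0_norm ?invr_ge0//.
have := rnormD (W x) (Y n (Y n x)); have := W_le1 x.
have := le_trans (IH (Y n x)) (ler_wpM2l (sqrt_rate_ge0 n) (IH x)).
lra.
Qed.

(** The iterates are polynomials in [W] and commute, so the next increment factors as
    [(Y n.+1 - Y n) (Y n.+1 + Y n) / 2]. The scalar increments factor in the same way and therefore
    dominate. *)
Lemma sqrt_iter_step n x :
  rnorm (Y n.+1 x - Y n x) <= (y n.+1 - y n) * rnorm x.
Proof.
elim: n x => [|n IH] x.
  by have := sqrt_iter_le 1 x; rewrite /= !subr0.
have -> : Y n.+2 x - Y n.+1 x =
    (2^-1)%:C *: (Y n.+1 (Y n.+1 x + Y n x) - Y n (Y n.+1 x + Y n x)).
  rewrite (sqrt_iterS n.+1 x) {2}(sqrt_iterS n x) -scalerBr; congr (_ *: _).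
  rewrite opprD addrACA subrr add0r !sqrt_iterD (sqrt_iter_comm n n.+1).
  by rewrite opprD addrA addrK.
rewrite rnormZr ger0_norm ?invr_ge0//.
have := IH (Y n.+1 x + Y n x); have := sqrt_rate_ler n.
have := rnormD (Y n.+1 x) (Y n x).
have := sqrt_iter_le n x; have := sqrt_iter_le n.+1 x.
set p := rnorm (Y n.+1 x); set q := rnorm (Y n x); set r := rnorm (_ + _).
set w := rnorm (_ - _).
have -> : y n.+2 = (1 + y n.+1 ^+ 2) / 2 by [].
have -> : y n.+1 ^+ 2 = y n.+1 * y n.+1 by [].
move=> h1 h2 h3 h4 h5.
have h6 : w <= (y n.+1 - y n) * ((y n.+1 + y n) * rnorm x).
  apply: le_trans h5 _; rewrite ler_wpM2l ?subr_ge0//; lra.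
suff -> : (1 + y n.+1 * y n.+1) / 2 - y n.+1 =
    2^-1 * ((y n.+1 - y n) * (y n.+1 + y n)) by lra.
by rewrite {3}/sqrt_rate -/(y n); ring.
Qed.

Lemma sqrt_iter_cauchy n m x : (n <= m)%N ->
  rnorm (Y m x - Y n x) <= (y m - y n) * rnorm x.
Proof.
elim: m => [|m IH]; first by rewrite leqn0 => /eqP->; rewrite !subrr rnorm0 mul0r.
rewrite leq_eqVlt => /orP[/eqP->|/IH {}IH]; first by rewrite !subrr rnorm0 mul0r.
apply: le_trans (rnorm_trans _ (Y m x) _) _.
by have := sqrt_iter_step m x; lra.
Qed.

(** The last clause is the fixed-point equation [Z = (W + Z^2) / 2], equivalently
    [(1 - Z)^2 = 1 - W]. *)
Lemma sqrt_limit : exists Z : bop H H, [/\ forall x, rnorm (Z x) <= rnorm x,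
  forall x z, rinner (Z x) z = rinner x (Z z) &
  forall x, Z (Z x) = Z x + Z x - W x].
Proof.
have d0 := sqrt_rate_cvg; pose d n := 1 - y n; rewrite -/d in d0.
have d_ge0 n : 0 <= d n by rewrite subr_ge0 sqrt_rate_le1.
have /choice[Z ZP] : forall x, exists z, forall n, rnorm (Y n x - z) <= rnorm x * d n.
  move=> x; apply: cvg_rate => [|n m nm].
    exact: cvg0_mul.
  rewrite rnormB; apply: le_trans (sqrt_iter_cauchy _ nm) _.
  by rewrite mulrC ler_wpM2l ?rnorm_ge0// lerB ?sqrt_rate_le1.
have Z_le x : rnorm (Z x) <= rnorm x.
  rewrite -subr_le0; apply: (le0_rate (c := rnorm x) d0) => n.
  have := ZP x n; rewrite rnormB; have := rnormD (Z x - Y n x) (Y n x).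
  rewrite subrK; have := sqrt_iter_le n x; have := rnorm_ge0 x.
  have := sqrt_rate_le1 n; nra.
have Zlin (a : R[i]) x z : Z (a *: x + z) = a *: Z x + Z z.
  apply: (vect_eq_rate (c := rnorm (a *: x + z) + complex.Re `|a| * rnorm x + rnorm z) d0).
  move=> n; apply: le_trans (rnorm_trans _ (Y n (a *: x + z)) _) _.
  rewrite !mulrDl -addrA rnormB; apply: lerD; first exact: ZP.
  rewrite sqrt_iter_lin opprD addrACA -scalerBr.
  apply: le_trans (rnormD _ _) _; apply: lerD; last exact: ZP.
  rewrite rnormZ -mulrA ler_wpM2l//.
  by rewrite -ler0c RRe_real// ger0_real.
have [|F FZ] := bop_of_linear Zlin (c := 1); first by move=> x; rewrite mul1r.
exists F; split=> [x|x z|x]; rewrite !FZ //.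
- apply: (eq_rate (c := rnorm x * rnorm z + rnorm x * rnorm z) d0) => n.
  have -> : rinner (Z x) z - rinner x (Z z) =
      rinner x (Y n z - Z z) - rinner (Y n x - Z x) z.
    by rewrite !rinnerE sqrt_iter_self; ring.
  apply: le_trans (ler_normB _ _) _; rewrite mulrDl; apply: lerD.
    apply: le_trans (rinner_le _ _) _.
    by rewrite -mulrA ler_wpM2l ?rnorm_ge0.
  apply: le_trans (rinner_le _ _) _.
  by rewrite mulrAC ler_wpM2r ?rnorm_ge0.
- apply: (vect_eq_rate (c := 4 * rnorm x) d0) => n.
  (* Since [2 Y n.+1 x = W x + Y n (Y n x)], the defect splits into three errors, of norm at most 1,
     1 and 2 times [|x| d n]. *)
  have -> : Z (Z x) - (Z x + Z x - W x) =
      (Z (Z x) - Y n (Z x)) + (Y n (Z x) - Y n (Y n x)) + 2%:C *: (Y n.+1 x - Z x).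
    rewrite sqrt_iterS scalerBr scalerA -rmorphM mulfV ?pnatr_eq0// scale1r.
    rewrite rmorph_nat scaler_nat mulr2n (addrC (W x)).
    by rewrite subrKA -[_ + W x - _]addrA subrKA opprB.
  apply: le_trans (rnormD _ _) _; rewrite rnormZr ger0_norm//.
  have := rnormD (Z (Z x) - Y n (Z x)) (Y n (Z x) - Y n (Y n x)).
  rewrite -sqrt_iterB; have := ZP (Z x) n; have := ZP x n; have := ZP x n.+1.
  have := ler_wpM2r (d_ge0 n) (Z_le x).
  have := sqrt_iter_le n (Z x - Y n x); rewrite (rnormB (Z (Z x))) (rnormB (Z x)).
  have := ler_wpM2r (rnorm_ge0 (Y n x - Z x)) (sqrt_rate_le1 n).
  have : rnorm x * d n.+1 <= rnorm x * d n.
    by rewrite ler_wpM2l ?rnorm_ge0// lerB ?sqrt_rate_ler.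
  lra.
Qed.

End SquareRoot.

(** * Existence of positive square roots *)

Section SquareRootOperator.
Variables (R : realType) (H : hilbertType R) (A : bop H H).
Hypothesis A_pos : bop_pos A.

Lemma bop_sqrt_exists : exists B : bop H H, bop_pos B /\ B \o B =1 A.
Proof.
have [c c0 Ac] := bop_rbounded A.
(* In the expansion of the square, [|A x|^2 / c^2 <= <A x, x> / c] by [bop_pos_sqr_le], which the
   cross term absorbs. *)
have W_le x : rnorm (x - (c^-1)%:C *: A x) <= rnorm x.
  rewrite -ler_sqr ?nnegrE ?rnorm_ge0// -!rinnerxx !rinnerE.
  rewrite (rinnerC x (A x)) (rinnerxx (A x)).
  have := bop_pos_sqr_le A_pos x c0 Ac; have := rinner_pos A_pos x.
  set p := rinner _ _; set q := rnorm _ ^+ 2 => p0 pq.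
  have h1 : c^-1 * (c^-1 * q) <= c^-1 * p by rewrite ler_pM2l ?invr_gt0// ler_pdivrMl.
  have h2 : 0 <= c^-1 * p by rewrite mulr_ge0 ?invr_ge0 ?(ltW c0).
  lra.
have [||W WE] := @bop_of_linear _ _ _ (fun x => x - (c^-1)%:C *: A x) 1.
- move=> a x y; rewrite linearP scalerDr !scalerA (mulrC _ a) -scalerA opprD.
  by rewrite addrACA -scalerBr.
- by move=> x; rewrite mul1r.
have W_self : bop_self W.
  move=> x y; rewrite !WE innerDl innerDr innerNl innerNr innerZl innerZr.
  have -> : Num.conj (c^-1)%:C = (c^-1)%:C by exact: conjc_real.
  by rewrite (bop_pos_self A_pos).
have [|Z [Z_le Z_self ZZ]] := sqrt_limit W_self; first by move=> x; rewrite WE.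
(* With [W = 1 - A / c], the operator [s (1 - Z)] squares to [c (1 - W) = A]. *)
pose s : R := Num.sqrt c.
have [||B BE] := @bop_of_linear _ _ _ (fun x => s%:C *: (x - Z x)) (s * 2).
- move=> a x y; rewrite linearP opprD addrACA -scalerBr scalerDr !scalerA.
  by rewrite (mulrC a).
- move=> x; rewrite rnormZr ger0_norm ?sqrtr_ge0// -mulrA ler_wpM2l ?sqrtr_ge0//.
  by have := rnormD x (- Z x); rewrite rnormN; have := Z_le x; lra.
exists B; split=> x /=; rewrite !BE.
  (* Symmetry of [Z] makes [<Z x, x>] real; [|Z x| <= |x|] then gives positivity of [1 - Z]. *)
  have im0 : rinner (Z x) ('i *: x) = 0.
    have := Z_self x ('i *: x); rewrite linearZ_LR.
    rewrite /rinner !innerZr (innerC x); case: (inner (Z x) x) => a b /=; lra.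
  rewrite innerZl innerDl innerNl innerxx inner_rinner im0.
  rewrite mulr_ge0 ?ler0c ?sqrtr_ge0// lecE /= subr0 eqxx subr_ge0.
  apply: le_trans (rinner_le1 _ _) _.
  by rewrite expr2 ler_wpM2r ?rnorm_ge0.
rewrite (linearZ_LR Z) (linearB Z) -scalerBr scalerA -rmorphM /= -expr2 sqr_sqrtr ?ltW//.
rewrite ZZ opprB -!addrA addKr (addrC (- W x)) addNKr WE subKr scalerA -rmorphM.
by rewrite mulfV ?gt_eqF// scale1r.
Qed.

Lemma bop_sqrtP : bop_pos (bop_sqrt A) /\ bop_sqrt A \o bop_sqrt A =1 A.
Proof.
rewrite /bop_sqrt; case: xgetP => // noB; exfalso.
by have [B BP] := bop_sqrt_exists; exact: noB BP.
Qed.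

End SquareRootOperator.

(** * Absolute values and their square roots *)

Section AbsoluteValue.
Variables (R : realType) (H K : hilbertType R) (C : bop H K).

Lemma bop_abs_spec :
  bop_pos (bop_abs C) /\ bop_abs C \o bop_abs C =1 bop_adj C \o C.
Proof.
by apply: bop_sqrtP => x /=; rewrite -bop_adjPr -sqr_norm_inner exprn_ge0.
Qed.

Lemma bop_absM x : bop_abs C (bop_abs C x) = bop_adj C (C x).
Proof. exact: bop_abs_spec.2. Qed.

Lemma bop_abs_self : bop_self (bop_abs C).
Proof. exact: bop_pos_self bop_abs_spec.1. Qed.

Lemma rnorm_bop_abs x : rnorm (bop_abs C x) = rnorm (C x).
Proof.
apply/eqP; rewrite -(@eqrXn2 _ 2) ?rnorm_ge0// -!rinnerxx /rinner.
by rewrite bop_abs_self bop_absM -bop_adjP.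
Qed.

Lemma bop_abs_eq0 x : bop_abs C x = 0 <-> C x = 0.
Proof.
by split=> x0; apply: rnorm_eq0; [rewrite -rnorm_bop_abs|rewrite rnorm_bop_abs];
   rewrite x0 rnorm0.
Qed.

Local Notation P := (bop_sqrt (bop_abs C)).

Lemma sqrt_abs_spec : bop_pos P /\ P \o P =1 bop_abs C.
Proof. exact/bop_sqrtP/bop_abs_spec.1. Qed.

Lemma sqrt_abs_self : bop_self P.
Proof. exact: bop_pos_self sqrt_abs_spec.1. Qed.

(** Turns the denominators of the quotients into the squared norms that Douglas' lemma compares. *)
Lemma rnorm_sqrt_abs x : rnorm (P x) ^+ 2 = rinner (bop_abs C x) x.
Proof.
rewrite -rinnerxx /rinner sqrt_abs_self [P (P x)](sqrt_abs_spec.2 x).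
by rewrite -bop_abs_self.
Qed.

End AbsoluteValue.

(** * Uniform boundedness and range inclusion *)


(* The uniform boundedness principle, by Sokal's gliding hump: move by
   [± 3^-n b_n / |b_n|] at step [n], with the sign that increases
   [|<b_n, x>|]; later steps undo at most half of this gain. *)
Lemma weakly_bounded (R : realType) (H : hilbertType R) (I : Type) (b : I -> H) :
  (forall h, exists M : R, forall i, `|rinner (b i) h| <= M) ->
  exists M : R, forall i, rnorm (b i) <= M.
Proof.
move=> wb; apply: contrapT => nb.
have r3 : (3^-1 : R) > 0 by rewrite invr_gt0.
(* The factor 2 leaves more than [n] when half of the gain is lost. *)
have /choice[v vP] : forall n, exists i, 2 * n%:R < 3^-1 ^+ n * rnorm (b i).
  move=> n; apply: contrapT => nv; apply: nb; exists (2 * n%:R / 3^-1 ^+ n) => i.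
  rewrite ler_pdivlMr ?exprn_gt0// mulrC leNgt; apply/negP => vi.
  by apply: nv; exists i.
have b0 n : 0 < rnorm (b (v n)).
  by rewrite -(pmulr_rgt0 _ (exprn_gt0 n r3)); apply: le_lt_trans (vP n); rewrite mulr_ge0.
pose t n x : R := 3^-1 ^+ n / rnorm (b (v n)) *
  (if 0 <= rinner (b (v n)) x then 1 else -1).
pose fix u n : H := if n is m.+1 then u m + (t m (u m))%:C *: b (v m) else 0.
have u_gain n : 3^-1 ^+ n * rnorm (b (v n)) <= `|rinner (b (v n)) (u n.+1)|.
  rewrite /= rinnerDr rinnerZr rinnerxx /t; set p := rinner _ _.
  have -> : forall s : R, 3^-1 ^+ n / rnorm (b (v n)) * s * rnorm (b (v n)) ^+ 2 =
      3^-1 ^+ n * rnorm (b (v n)) * s.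
    by move=> s; field; exact: lt0r_neq0 (b0 n).
  have := exprn_gt0 n r3; have := b0 n; set q := rnorm _; set r := _ ^+ n => q0 r0.
  have qr0 := mulr_gt0 r0 q0; case: ifPn => p0.
    by apply: le_trans (ler_norm _); lra.
  by rewrite -normrN; apply: le_trans (ler_norm _); rewrite -ltNge in p0; lra.
have u_step n : rnorm (u n.+1 - u n) = 3^-1 ^+ n.
  rewrite /= addrC addKr rnormZr /t normrM.
  rewrite (_ : `|if _ then _ else _| = 1) ?mulr1; last by case: ifP; rewrite ?normrN normr1.
  by rewrite ger0_norm ?divfK ?gt_eqF// divr_ge0 ?exprn_ge0 ?rnorm_ge0// ltW.
have u_far n m : (n <= m)%N -> rnorm (u m - u n) <= 3 / 2 * (3^-1 ^+ n - 3^-1 ^+ m).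
  elim: m => [|m IH]; first by rewrite leqn0 => /eqP->; rewrite !subrr rnorm0 mulr0.
  rewrite leq_eqVlt => /orP[/eqP->|/IH {}IH]; first by rewrite !subrr rnorm0 mulr0.
  apply: le_trans (rnorm_trans _ (u m) _) _; rewrite u_step exprS; lra.
(* At index [n.+1] this rate is half the length [3^-n] of step [n], so at least half of the gain of
   that step remains at [y]. *)
have [y uy] : exists y, forall n, rnorm (u n - y) <= 3 / 2 * 3^-1 ^+ n.
  apply: cvg_rate => [|n m nm].
    apply/cvg0_mul/cvg_expr.
    by rewrite ger0_norm ?invf_lt1 ?ltr1n// ltW.
  rewrite rnormB; apply: le_trans (u_far _ _ nm) _.
  by rewrite ler_pM2l ?divr_gt0// gerBl exprn_ge0// ltW.
have [M yM] := wb y; pose n := (Num.truncn M).+1.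
have Mn : M < n%:R by exact: truncnS_gt.
have := yM (v n); apply/negP; rewrite -ltNge; apply: lt_le_trans Mn _.
have := uy n.+1; have := u_gain n; have := vP n; rewrite exprS.
set r := _ ^+ n => h1 h2 h3.
have h4 : `|rinner (b (v n)) (u n.+1 - y)| <= rnorm (b (v n)) * (r / 2).
  apply: le_trans (rinner_le _ _) _; rewrite ler_pM2l//; lra.
have : `|rinner (b (v n)) (u n.+1)| <=
    `|rinner (b (v n)) (u n.+1 - y)| + `|rinner (b (v n)) y|.
  by apply: le_trans (ler_normD _ _); rewrite -rinnerDr subrK.
lra.
Qed.

(** * Douglas' lemma: range inclusion and majorization *)

Section Douglas.
Variables (R : realType) (H K L : hilbertType R) (B : bop H K) (D : bop L K).

(** If [B h = D y], then [|<B^* x, h>| = |<D^* x, y>| <= |y|] whenever [|D^* x| <= 1], so these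
    vectors [B^* x] are weakly bounded. *)
Lemma douglas_range : range B `<=` range D ->
  exists c : R, forall x, rnorm (bop_adj B x) <= c * rnorm (bop_adj D x).
Proof.
move=> BD.
pose b (i : {x : K | rnorm (bop_adj D x) <= 1}) := bop_adj B (sval i).
have [M bM] : exists M : R, forall i, rnorm (b i) <= M.
  apply: weakly_bounded => h; have [y _ yh] := BD _ (imageT B h).
  exists (rnorm y) => -[x /= x1].
  have -> : rinner (bop_adj B x) h = rinner (bop_adj D x) y.
    by rewrite /rinner -!bop_adjPr yh.
  by apply: le_trans (rinner_le _ _) _; rewrite ler_piMl ?rnorm_ge0.
exists M => x; rewrite -subr_le0.
apply: (le0_rate (c := M) (@cvg_harmonic R)) => n.
(* [D^* x] may vanish, so [x] is divided by [|D^* x| + e], and [e] tends to 0. *)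
have := @harmonic_gt0 R n; set e := harmonic n => e0.
have s0 : 0 < rnorm (bop_adj D x) + e by rewrite ltr_wpDl ?rnorm_ge0.
have x1 : rnorm (bop_adj D ((rnorm (bop_adj D x) + e)^-1%:C *: x)) <= 1.
  rewrite linearZ_LR rnormZr gtr0_norm ?invr_gt0// ler_pdivrMl// mulr1.
  by rewrite lerDl ltW.
have := bM (exist (fun z => is_true (rnorm (bop_adj D z) <= 1)) _ x1); rewrite /b /=.
rewrite linearZ_LR rnormZr.
rewrite gtr0_norm ?invr_gt0// ler_pdivrMl//; lra.
Qed.

Lemma range_factor (X : bop H L) : B =1 D \o X -> range B `<=` range D.
Proof. by move=> BX _ [h _ <-]; exists (X h) => //; rewrite BX. Qed.

Lemma douglas : range B `<=` range D <->
  exists c : R, forall x, rnorm (bop_adj B x) <= c * rnorm (bop_adj D x).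
Proof.
split; first exact: douglas_range.
by case=> c /douglas_factor[X [BX _]]; exact: range_factor BX.
Qed.

End Douglas.

Lemma bop_adj_self (R : realType) (H : hilbertType R) (A : bop H H) :
  bop_self A -> bop_adj A =1 A.
Proof. by move=> Aself x; apply: inner_extr => z; rewrite -bop_adjP Aself. Qed.

(** Translates finiteness of a supremum into a majorization; it is applied with [D] the square root
    of [P]. *)
Lemma sup_quotient_lty (R : realType) (H K L : hilbertType R) (B : bop H K)
    (P : bop H H) (D : bop H L) :
    (forall x, rnorm (D x) ^+ 2 = rinner (P x) x) ->
  (sup_quotient B P < +oo)%E <->
  exists c : R, forall x, rnorm (B x) <= c * rnorm (D x).
Proof.
move=> DP; rewrite /sup_quotient; set Q := [set _ | _ in _].
have QE x : ((complex.Re (`|B x| ^+ 2))%:E / (complex.Re (inner (P x) x))%:E =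
    (rnorm (B x) ^+ 2)%:E / (rnorm (D x) ^+ 2)%:E)%E.
  by rewrite DP normE -rmorphXn.
split=> [Qoo|[c BD]].
  have Q_le x : ((rnorm (B x) ^+ 2)%:E / (rnorm (D x) ^+ 2)%:E <= ereal_sup Q)%E.
    by apply: ereal_sup_ubound; exists x => //; rewrite QE.
  (* The quotient 0 / 0 = 0 at [x = 0] keeps the supremum away from [-oo]. *)
  have Q0 : (0 <= ereal_sup Q)%E.
    by apply: le_trans (Q_le 0); rewrite raddf0 rnorm0 expr0n mul0e.
  have [r rQ] : exists r, ereal_sup Q = r%:E.
    by exists (fine (ereal_sup Q)); rewrite fineK// ge0_fin_numE.
  rewrite rQ lee_fin in Q_le Q0.
  (* [r] bounds the squared ratio, and [r <= (r + 1)^2] avoids a square root. *)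
  exists (r + 1) => x; have := Q_le x.
  have [->|D0] := eqVneq (rnorm (D x)) 0.
    have [->|B0] := eqVneq (rnorm (B x)) 0; first by rewrite mulr0.
    (* A positive numerator over zero would give [+oo <= r]. *)
    rewrite expr0n inve0 gt0_muley// lte_fin exprn_gt0// lt_neqAle eq_sym B0.
    exact: rnorm_ge0.
  have D1 : 0 < rnorm (D x) by rewrite lt_neqAle eq_sym D0 rnorm_ge0.
  rewrite inver sqrf_eq0 (negbTE D0) -EFinM lee_fin ler_pdivrMr ?exprn_gt0// => h.
  rewrite -ler_sqr ?nnegrE ?rnorm_ge0 ?mulr_ge0 ?rnorm_ge0 ?addr_ge0//.
  apply: le_trans h _; rewrite exprMn ler_wpM2r ?exprn_ge0 ?rnorm_ge0//; nra.
apply: (@le_lt_trans _ _ (c ^+ 2)%:E); last exact: ltry.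
apply: ge_ereal_sup => _ [x _ <-]; rewrite QE.
have := BD x; have [->|D0] := eqVneq (rnorm (D x)) 0.
  rewrite mulr0 => B0; have -> : rnorm (B x) = 0 by apply/le_anti; rewrite B0 rnorm_ge0.
  by rewrite expr0n mul0e lee_fin sqr_ge0.
have D1 : 0 < rnorm (D x) by rewrite lt_neqAle eq_sym D0 rnorm_ge0.
rewrite inver sqrf_eq0 (negbTE D0) -EFinM lee_fin ler_pdivrMr ?exprn_gt0// => h.
by rewrite -exprMn ler_sqr// nnegrE ?rnorm_ge0// (le_trans (rnorm_ge0 _) h).
Qed.

(** * Polar decomposition *)

Section Polar.
Variables (R : realType) (H K : hilbertType R) (C : bop H K).

Section PolarFactor.
Variable U : bop H K.
Hypothesis CU : C =1 U \o bop_abs C.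
Hypothesis kerU : forall x, C x = 0 -> U x = 0.

(** The adjoint of [C = U |C|]. Both hypotheses of the section hold for every polar factor and for
    the candidate in [polar_exists], so these identities serve both. *)
Lemma abs_polar_adj y : bop_abs C (bop_adj U y) = bop_adj C y.
Proof.
apply: inner_extr => z; rewrite -bop_adjP -bop_abs_self -bop_adjP.
by rewrite -[U (bop_abs C z)]CU.
Qed.

Lemma polar_adjK x : bop_adj U (U (bop_abs C x)) = bop_abs C x.
Proof.
apply/eqP; rewrite -subr_eq0; apply/eqP/rnorm_eq0/eqP; rewrite -sqrf_eq0 -rinnerxx.
set d := _ - _.
(* [|C| U^* U |C| = C^* C = |C|^2], so [d] lies in the kernel of [|C|], hence in that of [U]; this
   makes [d] orthogonal to both of its terms. *)
have Pd : bop_abs C d = 0.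
  by rewrite linearB /= abs_polar_adj -[U _]CU -bop_absM subrr.
have Ud : U d = 0 by apply/kerU/bop_abs_eq0.
rewrite {1}/d /rinner innerDl innerNl -bop_adjPr Ud bop_abs_self Pd.
by rewrite !inner0r subrr.
Qed.

Lemma abs_polar_adjK x : bop_abs C (bop_adj U (U x)) = bop_abs C x.
Proof.
apply: inner_extr => z; rewrite -!bop_abs_self -bop_adjP -[in RHS]polar_adjK.
by rewrite -bop_adjPr.
Qed.

(** As [C^* = |C| U^*], the vector [U U^* y - y] lies in the kernel of [C^*], which is that of
    [|C^*|], so [Q] kills it. *)
Lemma sqrt_abs_adj_polar y : let Q := bop_sqrt (bop_abs (bop_adj C)) in
  Q (U (bop_adj U y)) = Q y.
Proof.
move=> Q; apply/eqP; rewrite -subr_eq0 -(linearB Q); apply/eqP/rnorm_eq0/eqP.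
rewrite -sqrf_eq0 rnorm_sqrt_abs; set d := U _ - y.
have -> : bop_abs (bop_adj C) d = 0; last by rewrite rinner0l.
by apply/bop_abs_eq0; rewrite linearB /= -!abs_polar_adj abs_polar_adjK subrr.
Qed.

End PolarFactor.

Lemma polar_exists : exists U, polar_decomposition C U.
Proof.
(* The majorization is the equality of [|C x|] and the norm of [|C| x], whence the constant 1. *)
have [|V [CV Vz]] := @douglas_factor _ _ _ _ (bop_adj C) (bop_abs C) 1.
  by move=> x; rewrite bop_adjK (bop_adj_self (bop_abs_self C)) rnorm_bop_abs mul1r.
have CU : C =1 bop_adj V \o bop_abs C.
  move=> x; apply: inner_extr => z /=.
  by rewrite -bop_adjP -bop_abs_self -[bop_abs C (V z)]CV -bop_adjPr.
have kerU x : C x = 0 -> bop_adj V x = 0.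
  move=> Cx; apply: inner_extr => z; rewrite -bop_adjP Vz ?bop_abs_eq0//.
  by rewrite inner0r.
have absU x : bop_adj V x = 0 -> bop_abs C x = 0.
  by move=> Ux; rewrite -(abs_polar_adjK CU kerU) Ux !linear0.
exists (bop_adj V); split=> // [x x_orth|x]; last by split=> [/absU/bop_abs_eq0|/kerU].
(* With [U = V^*], [d = U^* U x - x] lies in the kernel of [U] and is orthogonal to it, so
   [U^* U x = x] and [U] is isometric at [x]. *)
pose d := bop_adj (bop_adj V) (bop_adj V x) - x.
have Pd : bop_abs C d = 0.
  by rewrite linearB /= (abs_polar_adjK CU kerU) subrr.
have Ud : bop_adj V d = 0 by apply/kerU/bop_abs_eq0.
have d0 : d = 0.
  apply/rnorm_eq0/eqP; rewrite -sqrf_eq0 -rinnerxx {1}/d /rinner innerDl innerNl.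
  by rewrite -bop_adjPr Ud x_orth// subr0 inner0r.
rewrite !normE; congr _%:C; apply/eqP; rewrite -(@eqrXn2 _ 2) ?rnorm_ge0//.
by rewrite -!rinnerxx /rinner bop_adjP (subr0_eq d0).
Qed.

End Polar.

(** * The equivalences, from Douglas' lemma and the polar factor *)

Theorem proposition3p7 (R : realType) (H1 H2 : hilbertType R) (A : bop H1 H2)
    (S : closed_subspace H1) (T : closed_subspace H2) :
  let A12 := block12 A S T in
  let A21 := block21 A S T in
  let A22 := block22 A S T in
  let statement1 := weakly_complementable A S T in
  let statement2 :=
    forall U : bop (orthc S) (orthc T), polar_decomposition A22 U ->
      (exists X : bop S (orthc S),
         A21 =1 bop_sqrt (bop_abs (bop_adj A22)) \o U \o X) /\
      (exists Y : bop T (orthc S),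
         bop_adj A12 =1 bop_sqrt (bop_abs A22) \o Y) in
  let statement3 :=
    (sup_quotient (bop_adj A21) (bop_abs (bop_adj A22)) < +oo)%E /\
    (sup_quotient A12 (bop_abs A22) < +oo)%E in
  (statement1 <-> statement2) /\ (statement1 <-> statement3).
Proof.
move=> A12 A21 A22; rewrite /weakly_complementable -/A12 -/A21 -/A22.
split; split.
- move=> [ran21 ran12] U [CU _ UC].
  have [c /douglas_factor[X [A21X _]]] := douglas_range ran21.
  have [d /douglas_factor[Y [A12Y _]]] := douglas_range ran12.
  split; last by exists Y.
  exists (bop_comp (bop_adj U) X) => s /=.
  by rewrite (sqrt_abs_adj_polar CU (fun x => (UC x).2)); exact: A21X.
(* The second statement quantifies over polar factors, so one must be produced before its solutions
   are available. *)
- move=> st2; have [U /st2[[X A21X] [Y A12Y]]] := polar_exists A22; split.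
    exact: (@range_factor _ _ _ _ _ _ (bop_comp U X)).
  exact: range_factor A12Y.
- move=> [/douglas_range ran21 /douglas_range ran12].
  split; apply/(sup_quotient_lty _ (rnorm_sqrt_abs _)).
    have [c A21c] := ran21; exists c => x.
    by rewrite -(bop_adj_self (sqrt_abs_self _)).
  have [c A12c] := ran12; exists c => x.
  (* Douglas' lemma for [A12^*] bounds the adjoint of [A12^*], which is [A12] again. *)
  by rewrite -(bop_adjK A12) -(bop_adj_self (sqrt_abs_self _)).
- case=> /(sup_quotient_lty _ (rnorm_sqrt_abs _))[c A21c].
  case/(sup_quotient_lty _ (rnorm_sqrt_abs _)) => d A12d.
  split; apply/douglas; [exists c | exists d] => x.
    by rewrite (bop_adj_self (sqrt_abs_self _)).
  by rewrite bop_adjK (bop_adj_self (sqrt_abs_self _)).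
Qed.
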